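(* The learning problem for $\mathbf{LTL}(\mathbf{X},\wedge)$ is in $\mathsf{NP}$: given words $u_1,\dots,u_n,v_1,\dots,v_n\in\Sigma^*$ and $k\in\mathbb{N}$ encoded in binary, deciding whether there exists a formula of $\mathbf{LTL}(\mathbf{X},\wedge)$ of size at most $k$ separating $u_1,\dots,u_n$ from $v_1,\dots,v_n$ is in $\mathsf{NP}$.
   Context: Alphabet $\Sigma=\{a,b\}$. Words are nonempty, indexed from position 1. $\mathbf{LTL}(\mathbf{X},\wedge)$: formulas built from letters $c\in\Sigma$, $\wedge$, and $\mathbf{X}$, with semantics on a word $w$ of length $\ell$ at position $i\in[1,\ell]$: $w,i\models c$ iff $w(i)=c$; $\wedge$ as usual; $w,i\models\mathbf{X}\phi$ iff $i<\ell$ and $w,i+1\models\phi$; $w\models\phi$ iff $w,1\models\phi$. Size = number of nodes of the syntax tree. $\phi$ separates $u_1,\dots,u_n$ from $v_1,\dots,v_m$ if all $u_j\models\phi$ and all $v_j\not\models\phi$. The input size is $O(n\ell+\log k)$ where $\ell$ is the maximal word length. *)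

(* Defs.v *)
From HB Require Import structures.
From mathcomp Require Import all_boot.
Set Implicit Arguments. Unset Strict Implicit. Unset Printing Implicit Defensive.

Inductive letter := La | Lb.
Definition letter_eqb (x y : letter) : bool :=
  match x, y with La, La | Lb, Lb => true | _, _ => false end.
Lemma letter_eqP : Equality.axiom letter_eqb.
Proof. by case; case; constructor. Qed.
HB.instance Definition _ := hasDecEq.Build letter letter_eqP.

Definition word := seq letter.

Inductive ltlxa :=
| FAtom of letter
| FAnd of ltlxa & ltlxa
| FX of ltlxa.

Fixpoint fsize (f : ltlxa) : nat :=
  match f with
  | FAtom _ => 1
  | FAnd f g => (fsize f + fsize g).+1
  | FX f => (fsize f).+1
  end.

(* w, i |= f, positions i in [1, size w] (1-based) *)
Fixpoint holds (w : word) (i : nat) (f : ltlxa) : Prop :=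
  match f with
  | FAtom c => 1 <= i <= size w /\ nth La w i.-1 = c
  | FAnd f g => holds w i f /\ holds w i g
  | FX f => 1 <= i < size w /\ holds w i.+1 f
  end.

Definition models (w : word) (f : ltlxa) : Prop := holds w 1 f.

Definition separates (f : ltlxa) (U V : seq word) : Prop :=
  (forall u, u \in U -> models u f) /\ (forall v, v \in V -> ~ models v f).

Inductive sym := Sa | Sb | S0 | S1 | Ssep | Sbar.

Definition sym_of_letter (c : letter) : sym := if c is La then Sa else Sb.

Definition enc_words (ws : seq word) : seq sym :=
  flatten (map (fun w => map sym_of_letter w ++ [:: Ssep]) ws).

(* binary, least significant bit first *)
Definition bin_val (bs : seq bool) : nat := foldr (fun (b : bool) (acc : nat) => (b : nat) + 2 * acc) 0 bs.
(* canonical: no leading zero (most significant bit, i.e. last, is 1); 0 = [::] *)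
Definition bin_canonical (bs : seq bool) : bool := last true bs.

Definition enc_inst (U V : seq word) (bs : seq bool) : seq sym :=
  enc_words U ++ Sbar :: enc_words V ++ Sbar :: map (fun b : bool => if b then S1 else S0) bs.

Definition LTLXA_learning (s : seq sym) : Prop :=
  exists (U V : seq word) (bs : seq bool),
    [/\ s = enc_inst U V bs, bin_canonical bs,
        all (fun w => 0 < size w) U, all (fun w => 0 < size w) V &
        exists f, fsize f <= bin_val bs /\ separates f U V].

Inductive move := MoveL | MoveR | MoveS.

Record TM (Sig : Type) := {
  tm_Q : finType;
  tm_G : finType;
  tm_blank : tm_G;
  tm_in : Sig -> tm_G;
  tm_in_inj : injective tm_in;
  tm_in_blank : forall s, tm_in s <> tm_blank;
  tm_start : tm_Q;
  tm_acc : tm_Q;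
  tm_delta : tm_Q -> tm_G -> tm_Q * tm_G * move
}.

Arguments tm_blank {Sig} t.
Arguments tm_start {Sig} t.
Arguments tm_acc {Sig} t.
Arguments tm_in {Sig} t _.
Arguments tm_delta {Sig} t _ _.

Section TMsem.
Variables (Sig : Type) (M : TM Sig).

(* state, left part (nearest cell first), scanned cell, right part *)
Definition config := (tm_Q M * seq (tm_G M) * tm_G M * seq (tm_G M))%type.

Definition tm_step (c : config) : config :=
  let: (q, l, h, r) := c in
  if q == tm_acc M then c else
  let: (q', h', m) := tm_delta M q h in
  match m with
  | MoveS => (q', l, h', r)
  | MoveL => match l with
             | [::] => (q', [::], h', r)
             | g :: l' => (q', l', g, h' :: r)
             end
  | MoveR => match r with
             | [::] => (q', h' :: l, tm_blank M, [::])
             | g :: r' => (q', h' :: l, g, r')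
             end
  end.

Definition tm_init (s : seq Sig) : config :=
  match map (tm_in M) s with
  | [::] => (tm_start M, [::], tm_blank M, [::])
  | g :: r => (tm_start M, [::], g, r)
  end.

Definition accepts_within (s : seq Sig) (t : nat) : Prop :=
  exists n, n <= t /\ (iter n tm_step (tm_init s)).1.1.1 = tm_acc M.
End TMsem.

Definition in_NP (Sig : Type) (L : seq Sig -> Prop) : Prop :=
  exists (M : TM (Sig + bool)%type) (c d : nat),
    forall x : seq Sig,
      L x <-> exists y : seq bool,
        size y <= c * (size x).+1 ^ d /\
        accepts_within M (map inl x ++ map inr y) (c * (size x).+1 ^ d).

(* Main.v *)
Require Import Defs.
From HB Require Import structures.
From mathcomp Require Import all_boot zify.
Set Implicit Arguments. Unset Strict Implicit. Unset Printing Implicit Defensive.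

(** A formula is equivalent to a finite set of constraints "letter c at offset j",
    and a cheapest formula for such a set is a chain that walks through the
    offsets with X and conjoins the letters on the way: its size is the maximal
    offset plus twice the number of constraints minus one.  Such a chain is
    written as a bit string, [0] for X and [1 c] for a letter constraint, whose
    length is the size of the formula plus one.  If some word u satisfies the
    formula, the chain is determined by a subset of the positions of u, so that it
    is short whatever k is; if there is no positive word, a short contradiction
    or a formula of size at most two does the job.

    The chain is the certificate.  The machine sweeps over its tape from left to
    right, with a letter-to-letter transducer, and each sweep consumes one bit of
    the certificate: it advances a pointer in all words simultaneously, or compares
    the letters under the pointers and records failures in the separators, and
    decrements the binary counter k, whose least significant bit comes first. *)

(** * Turing machines made of left-to-right sweeps *)

Section Sweep.
Variables (Sig : Type) (C S : finType) (inC : Sig -> C).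
Variables (s0 : S) (delta : S -> C -> S * C) (fin : S -> option S).
Hypothesis inC_inj : injective inC.

Fixpoint scan (s : S) (t : seq C) : S * seq C :=
  if t is c :: t' then
    let: (s1, c1) := delta s c in
    let: (s2, t2) := scan s1 t' in (s2, c1 :: t2)
  else (s, [::]).

Fixpoint sweeps (m : nat) (s : S) (t : seq C) : bool :=
  if m is m'.+1 then
    let: (s1, t1) := scan s t in
    if fin s1 is Some s2 then sweeps m' s2 t1 else true
  else false.

Lemma sweepsS m s t : sweeps m.+1 s t =
  if fin (scan s t).1 is Some s1 then sweeps m s1 (scan s t).2 else true.
Proof. by rewrite /=; case: (scan s t). Qed.

Lemma scan_cons s c t :
  scan s (c :: t) = ((scan (delta s c).1 t).1, (delta s c).2 :: (scan (delta s c).1 t).2).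
Proof. by rewrite /=; case: (delta s c) => s1 c1; case: (scan s1 t). Qed.

Lemma scan_cat s t1 t2 :
  scan s (t1 ++ t2) =
  ((scan (scan s t1).1 t2).1, (scan s t1).2 ++ (scan (scan s t1).1 t2).2).
Proof.
elim: t1 s => [|c t1 IH] s /=; first by case: (scan s t2).
case: (delta s c) => s1 c1; rewrite IH.
by case: (scan s1 t1).
Qed.

Lemma size_scan s t : size (scan s t).2 = size t.
Proof.
elim: t s => //= c t IH s; case: (delta s c) => s1 c1 /=.
by have := IH s1; case: (scan s1 t) => s2 t2 /= ->.
Qed.

(* [None] accepts, [Some None] marks the leftmost cell, which is how the
   rewinding phase [(true, s)] recognises the end of the one-sided tape. *)
Let Q : finType := option (option (bool * S)).
Let G : finType := option (C * bool).

Definition sweep_delta (q : Q) (g : G) : Q * G * move :=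
  match q, g with
  | Some None, Some (c, _) => (Some (Some (false, s0)), Some (c, true), MoveS)
  | Some (Some (false, s)), Some (c, m) =>
      let: (s1, c1) := delta s c in (Some (Some (false, s1)), Some (c1, m), MoveR)
  | Some (Some (false, s)), None =>
      if fin s is Some s1 then (Some (Some (true, s1)), None, MoveL)
      else (None, None, MoveS)
  | Some (Some (true, s)), Some (c, true) => (Some (Some (false, s)), g, MoveS)
  | Some (Some (true, s)), Some (c, false) => (q, g, MoveL)
  | _, _ => (q, g, MoveS)
  end.

Lemma sweep_in_inj : injective (fun a => Some (inC a, false) : G).
Proof. by move=> a b [] /inC_inj. Qed.

Definition sweep_TM : TM Sig :=
  @Build_TM Sig Q G None (fun a => Some (inC a, false)) sweep_in_inj
    (fun a => ltac:(discriminate)) (Some None) None sweep_delta.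

Notation step := (@tm_step Sig sweep_TM).
Notation cfg := (config sweep_TM).

Definition unmarked (t : seq C) : seq G := [seq Some (c, false) | c <- t].

Definition at_left (s : S) (c : C) (t : seq C) (r : seq G) : cfg :=
  (Some (Some (false, s)), [::], Some (c, true), unmarked t ++ r).

(** The two values of [k] are the possible right ends: no blank has been created before the first
    sweep, and exactly one exists after each completed sweep. *)
Lemma scan_steps s l c m t k : k <= 1 ->
  iter (size t).+1 step (Some (Some (false, s)), l, Some (c, m), unmarked t ++ nseq k None)
  = (Some (Some (false, (scan s (c :: t)).1)),
      catrev (unmarked (behead (scan s (c :: t)).2))
             (Some ((delta s c).2, m) :: l), None, [::]) :> cfg.
Proof.
move=> k1; elim: t s l c m => [|c' t IH] s l c m; rewrite iterSr.
  by rewrite /tm_step /=; case: (delta s c) => s1 c1 /=; case: k k1 => [|[|k]].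
have -> : step (Some (Some (false, s)), l, Some (c, m), unmarked (c' :: t) ++ nseq k None)
  = (Some (Some (false, (delta s c).1)), Some ((delta s c).2, m) :: l,
     Some (c', false), unmarked t ++ nseq k None).
  by rewrite /tm_step /=; case: (delta s c).
rewrite IH /=; case: (delta s c) => s1 c1 /=; case: (delta s1 c') => s2 c2 /=.
by case: (scan s2 t).
Qed.

(** Induction from the right, since rewinding passes the last cell first; the extra step turns round
    at the marked cell. *)
Lemma rewind_steps s c t r :
  iter (size t).+1 step
    (Some (Some (true, s)),
     (if rev t is x :: t' then unmarked t' ++ [:: Some (c, true)] else [::]),
     (if rev t is x :: _ then Some (x, false) else Some (c, true)), r)
  = at_left s c t r.
Proof.
elim/last_ind: t r => [|t x IH] r; first by [].
rewrite size_rcons rev_rcons iterSr.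
rewrite /at_left /unmarked map_rcons cat_rcons -/(at_left s c t (Some (x, false) :: r)) -IH.
by congr (iter _ _ _); case: (rev t).
Qed.

Lemma round_trip s c t k : k <= 1 ->
  let: (s1, t1) := scan s (c :: t) in
  iter (size t).+2 step (at_left s c t (nseq k None)) =
  if fin s1 is Some s2 then
    (Some (Some (true, s2)),
     (if rev (behead t1) is x :: t' then unmarked t' ++ [:: Some (head c t1, true)] else [::]),
     (if rev (behead t1) is x :: _ then Some (x, false) else Some (head c t1, true)),
     [:: None])
  else (None, (iter (size t).+1 step (at_left s c t (nseq k None))).1.1.2, None, [::]).
Proof.
move=> k1; rewrite iterS /at_left scan_steps //.
have : (head c (scan s (c :: t)).2) = (delta s c).2.
  by rewrite /=; case: (delta s c) => s1 c1; case: (scan s1 t).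
case E: (scan s (c :: t)) => [s1 t1] /= <-.
case: (fin s1) => [s2|//].
rewrite catrevE /unmarked -map_rev.
by case: (rev _) => [|x u] //=; rewrite cats1 -cat1s -cats1 -?catA.
Qed.

Lemma sweep_iter s c t k s1 t1 s2 : k <= 1 ->
  scan s (c :: t) = (s1, t1) -> fin s1 = Some s2 ->
  iter (2 * size t + 3) step (at_left s c t (nseq k None)) =
  at_left s2 (head c t1) (behead t1) (nseq 1 None).
Proof.
move=> k1 E F; have := round_trip s c t k1; rewrite E F => H.
have -> : 2 * size t + 3 = (size t).+1 + (size t).+2 by lia.
rewrite iterD H -rewind_steps size_behead.
by have := size_scan s (c :: t); rewrite E /= => ->.
Qed.

Lemma iter_step_acc (x : cfg) n m :
  n <= m -> (iter n step x).1.1.1 = tm_acc sweep_TM ->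
  (iter m step x).1.1.1 = tm_acc sweep_TM.
Proof.
move=> nm; rewrite -(subnK nm); elim: (m - n) => //= p IH H.
have := IH H; case: (iter _ _ _) => [[[q l] h] r] /= ->.
by [].
Qed.

Lemma sweeps_accept m s c t k : k <= 1 -> sweeps m s (c :: t) ->
  exists n, n <= m * (2 * size t + 3) /\
    (iter n step (at_left s c t (nseq k None))).1.1.1 = tm_acc sweep_TM.
Proof.
elim: m s c t k => // m IH s c t k k1; rewrite sweepsS.
have := round_trip s c t k1; have := @sweep_iter s c t k.
have := size_scan s (c :: t).
case: (scan s (c :: t)) => s1 t1; rewrite [(_, _).1]/= [(_, _).2]/= [size (_ :: _)]/=.
case F: (fin s1) => [s2|]; last first.
  by move=> _ _ H _; exists (size t).+2; split; [lia | rewrite H].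
case: t1 => // c1 t1 /= [szt] /(_ _ _ _ k1 erefl F) H _.
move=> /(IH _ _ _ 1 isT) [n [le_n acc]].
exists (n + (2 * size t + 3)); split; first by rewrite szt in le_n; lia.
by rewrite iterD H.
Qed.

(** Acceptance is absorbing, so it cannot occur within a round trip that ends in a working state;
    such trips are peeled off by strong induction on [n]. *)
Lemma accept_sweeps n s c t k : k <= 1 ->
  (iter n step (at_left s c t (nseq k None))).1.1.1 = tm_acc sweep_TM ->
  exists m, sweeps m s (c :: t).
Proof.
elim/ltn_ind: n s c t k => n IH s c t k k1 acc.
case E: (scan s (c :: t)) => [s1 t1]; case F: (fin s1) => [s2|]; last first.
  by exists 1; rewrite sweepsS E F.
have H := sweep_iter k1 E F.
case: (leqP n (2 * size t + 3)) => [le_n|lt_n].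
  by have := iter_step_acc le_n acc; rewrite H.
have := acc; rewrite -(subnK (ltnW lt_n)) iterD H => /IH [] //; first by lia.
have := size_scan s (c :: t); rewrite E; case: t1 E {H} => // c1 t1 E _ m Hm.
by exists m.+1; rewrite sweepsS E F.
Qed.

Lemma sweep_TM_complete (a : Sig) x m : sweeps m s0 (map inC (a :: x)) ->
  accepts_within sweep_TM (a :: x) (m * (2 * size x + 3) + 1).
Proof.
move=> /(@sweeps_accept _ _ _ _ 0 isT) [n [le_n acc]].
exists (n + 1); split; first by rewrite size_map in le_n; lia.
by rewrite iterD; move: acc; rewrite /at_left /unmarked cats0 /= -map_comp.
Qed.

Lemma sweep_TM_sound (x : seq Sig) k : accepts_within sweep_TM x k ->
  exists m, sweeps m s0 (map inC x).
Proof.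
case: x => [|a x] [n [_ acc]].
  (* On a blank cell the start state loops, so the empty input is never accepted. *)
  suff E : iter n step (tm_init sweep_TM [::]) = tm_init sweep_TM [::] by rewrite E in acc.
  by elim: n {acc} => //= n ->.
apply: (@accept_sweeps n _ _ _ 0) => //.
(* One spare step is added so that the initial marking step can be split off. *)
have := iter_step_acc (leqnSn n) acc.
by rewrite iterSr /at_left /unmarked cats0 /= -map_comp.
Qed.

End Sweep.

(** * The verifier *)

Definition sym_code (s : sym) : option (option (option bool)) * bool :=
  match s with
  | Sa => (None, false) | Sb => (None, true)
  | S0 => (Some None, false) | S1 => (Some None, true)
  | Ssep => (Some (Some None), false) | Sbar => (Some (Some None), true)
  end.

Definition sym_decode (c : option (option (option bool)) * bool) : sym :=
  match c with
  | (None, b) => if b then Sb else Sa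
  | (Some None, b) => if b then S1 else S0
  | (Some _, b) => if b then Sbar else Ssep
  end.

Lemma sym_codeK : cancel sym_code sym_decode.
Proof. by case. Qed.

HB.instance Definition _ := Finite.copy sym (can_type sym_codeK).

(* [OpNop] is the operation of the first bit of a token [1 c]. *)
Inductive op := OpX | OpNop | OpChk of bool.

Definition op_code (o : op) : option (option bool) :=
  match o with OpX => None | OpNop => Some None | OpChk b => Some (Some b) end.

Definition op_decode (c : option (option bool)) : op :=
  match c with None => OpX | Some None => OpNop | Some (Some b) => OpChk b end.

Lemma op_codeK : cancel op_code op_decode.
Proof. by case. Qed.

HB.instance Definition _ := Finite.copy op (can_type op_codeK).

Definition is_chk (o : op) : bool := if o is OpChk _ then true else false.

Definition next_op (o : op) (b : bool) : op :=
  if o is OpNop then OpChk b else if b then OpNop else OpX.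

(* [FmtWord v w], [FmtNum] and [FmtGot] belong to the first sweep, which checks
   the format of the input: [v] tells whether the negative words have been reached,
   [w] whether the current word is nonempty, and the argument of [FmtNum] is the
   last bit of the counter.  The other states apply an operation: [ok] is the
   verdict on the words read so far, and [seen] is the outcome of the operation
   on the current word once its first unmarked letter has been met. *)
Inductive state :=
| Dead
| FmtWord of bool & bool
| FmtNum of bool
| FmtGot of bool
| Word of op & bool & bool & option bool
| Num of op & bool & bool
| Got of op & bool.

Definition state_code (s : state) :
    unit + bool * bool + bool + bool + op * bool * bool * option bool
    + op * bool * bool + op * bool :=
  match s with
  | Dead => inl (inl (inl (inl (inl (inl tt)))))
  | FmtWord v w => inl (inl (inl (inl (inl (inr (v, w))))))
  | FmtNum b => inl (inl (inl (inl (inr b))))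
  | FmtGot b => inl (inl (inl (inr b)))
  | Word o ok v seen => inl (inl (inr (o, ok, v, seen)))
  | Num o ok w => inl (inr (o, ok, w))
  | Got o b => inr (o, b)
  end.

Definition state_decode (c : unit + bool * bool + bool + bool + op * bool * bool * option bool
    + op * bool * bool + op * bool) : state :=
  match c with
  | inl (inl (inl (inl (inl (inl _))))) => Dead
  | inl (inl (inl (inl (inl (inr (v, w)))))) => FmtWord v w
  | inl (inl (inl (inl (inr b)))) => FmtNum b
  | inl (inl (inl (inr b))) => FmtGot b
  | inl (inl (inr (o, ok, v, seen))) => Word o ok v seen
  | inl (inr (o, ok, w)) => Num o ok w
  | inr (o, b) => Got o b
  end.

Lemma state_codeK : cancel state_code state_decode.
Proof. by case. Qed.

HB.instance Definition _ := Finite.copy state (can_type state_codeK).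

(* The mark means "already passed" on a letter, "violates a constraint" on the
   separator after a word, and "already read" on a bit of the certificate. *)
Definition cell : finType := ((sym + bool) * bool)%type.

Definition letter_step (o : op) (seen : option bool) (c m : bool) : option bool * bool :=
  if seen is Some _ then (seen, m)
  else if m then (None, true)
  else match o with
       | OpX => (Some true, true)
       | OpNop => (Some true, false)
       | OpChk c' => (Some (c == c'), false)
       end.

(** [None] at the separator means that the offset lies beyond the word, which violates a letter
    constraint just as a wrong letter does. *)
Definition sep_bad (o : op) (seen : option bool) (bad : bool) : bool :=
  bad || is_chk o && (seen != Some true).

(** In [Num] the last flag is a pending borrow, absorbed by the lowest bit 1; if it survives to the
    first unread certificate bit, the counter was 0. [Got] forgets the verdict, as the marked
    separators carry the failures to the next sweep. *)
Definition delta (s : state) (x : cell) : state * cell :=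
  let: (a, m) := x in
  match s, a with
  | FmtWord v _, inl Sa | FmtWord v _, inl Sb => (FmtWord v true, x)
  | FmtWord v true, inl Ssep => (FmtWord v false, x)
  | FmtWord v false, inl Sbar => (if v then FmtNum true else FmtWord true false, x)
  | FmtNum _, inl S0 => (FmtNum false, x)
  | FmtNum _, inl S1 => (FmtNum true, x)
  | FmtNum true, inr b => (FmtGot b, (a, true))
  | FmtGot _, inr _ => (s, x)
  | Word o ok v seen, inl Sa =>
      let: (seen', m') := letter_step o seen false m in (Word o ok v seen', (a, m'))
  | Word o ok v seen, inl Sb =>
      let: (seen', m') := letter_step o seen true m in (Word o ok v seen', (a, m'))
  | Word o ok v seen, inl Ssep =>
      let bad := sep_bad o seen m in (Word o (ok && (bad == v)) v None, (a, bad))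
  | Word o ok v _, inl Sbar => (if v then Num o ok true else Word o ok true None, x)
  | Num o ok w, inl S0 => (s, (inl (if w then S1 else S0), m))
  | Num o ok w, inl S1 => (Num o ok false, (inl (if w then S0 else S1), m))
  | Num o ok w, inr b => if m then (s, x) else (if w then Dead else Got o b, (a, true))
  | Got _ _, inr _ => (s, x)
  | _, _ => (Dead, x)
  end.

Definition start (o : op) : state := Word o true false None.

(* An underflow of the counter is harmless in the last sweep, as the certificate
   is one bit longer than the formula; in the earlier ones [delta] stops. *)
Definition fin (s : state) : option state :=
  match s with
  | FmtGot b => Some (start (next_op OpX b))
  | Got o b => Some (start (next_op o b))
  | Num o ok _ => if ok && is_chk o then None else Some Dead
  | _ => Some Dead
  end.

Notation lscan := (scan delta).
Notation lsweeps := (sweeps delta fin).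

(** * Effect of the sweeps on a well-formed tape *)

Lemma scan_Dead t : (lscan Dead t).1 = Dead.
Proof. by elim: t => //= -[a m] t /=; case: (lscan Dead t). Qed.

Lemma sweeps_Dead m t : lsweeps m Dead t = false.
Proof. by elim: m t => // m IH t; rewrite sweepsS scan_Dead /= IH. Qed.

Definition letter_of (b : bool) : letter := if b then Lb else La.

Definition op_off (o : op) (j : nat) : nat := if o is OpX then j.+1 else j.

Definition op_bad (o : op) (j : nat) (w : word) : bool :=
  if o is OpChk b then onth w j != Some (letter_of b) else false.

Definition letter_cell (m : bool) (c : letter) : cell := (inl (sym_of_letter c), m).

(** The pointer is stored in unary as a marked prefix; [take] and [drop] saturate, so it stops at
    the end of the word while [j] may keep growing. *)
Definition word_cells (j : nat) (bad : bool) (w : word) : seq cell :=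
  map (letter_cell true) (take j w) ++ map (letter_cell false) (drop j w)
  ++ [:: (inl Ssep, bad)].

Definition words_cells (j : nat) (f : word -> bool) (ws : seq word) : seq cell :=
  flatten [seq word_cells j (f w) w | w <- ws].

Definition bit_cell (b : bool) : cell := (inl (if b then S1 else S0), false).

Definition cert_cell (m b : bool) : cell := (inr b, m).

Definition tape (j : nat) (f : word -> bool) (U V : seq word) (bs y1 y2 : seq bool) :=
  words_cells j f U ++ (inl Sbar, false) :: words_cells j f V ++
  (inl Sbar, false) :: map bit_cell bs ++ map (cert_cell true) y1 ++ map (cert_cell false) y2.

Fixpoint borrow (w : bool) (bs : seq bool) : bool :=
  if bs is b :: bs' then borrow (w && ~~ b) bs' else w.

Fixpoint decr (w : bool) (bs : seq bool) : seq bool :=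
  if bs is b :: bs' then (b (+) w) :: decr (w && ~~ b) bs' else [::].

Lemma borrowE w bs : borrow w bs = (bin_val bs < w).
Proof. by elim: bs w => [|b bs IH] [] //=; rewrite IH; case: b => /=; lia. Qed.

Lemma bin_val_decr (w : bool) bs : w <= bin_val bs -> bin_val (decr w bs) = bin_val bs - w.
Proof.
elim: bs w => [|b bs IH] w /=; first by case: w.
by case: w; case: b => /= H; rewrite IH /=; lia.
Qed.

Lemma scan_num o ok w bs :
  lscan (Num o ok w) (map bit_cell bs) = (Num o ok (borrow w bs), map bit_cell (decr w bs)).
Proof. by elim: bs w => // -[] bs IH [] /=; rewrite IH. Qed.

Lemma scan_eaten o ok v t :
  lscan (Word o ok v None) (map (letter_cell true) t)
  = (Word o ok v None, map (letter_cell true) t).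
Proof. by elim: t => // -[] t /= ->. Qed.

Lemma scan_seen o ok v r t :
  lscan (Word o ok v (Some r)) (map (letter_cell false) t)
  = (Word o ok v (Some r), map (letter_cell false) t).
Proof. by elim: t => // -[] t /= ->. Qed.

Lemma scan_word o ok v j bad w :
  let bad' := bad || op_bad o j w in
  lscan (Word o ok v None) (word_cells j bad w) =
  (Word o (ok && (bad' == v)) v None, word_cells (op_off o j) bad' w).
Proof.
have drop1 k : drop k w = (if k < size w then nth La w k :: drop k.+1 w else [::]).
  by case: ltnP => H; [rewrite (drop_nth La) | rewrite drop_oversize].
rewrite /word_cells !scan_cat scan_eaten /= (drop1 j).
case: ltnP => [lt_j|le_j]; last first.
  rewrite /sep_bad (take_oversize le_j).
  have -> : op_bad o j w = is_chk o && true by case: o; rewrite //= onth_default.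
  by rewrite take_oversize ?drop_oversize //; case: o => //=; lia.
have on : onth w j = Some (nth La w j) by rewrite onthE (nth_map La).
case: o => [||b] /=.
- rewrite (take_nth La lt_j) map_rcons cat_rcons.
  by case: (nth La w j); rewrite /= scan_seen /= /sep_bad.
- rewrite (drop1 j) lt_j.
  by case: (nth La w j); rewrite /= scan_seen /= /sep_bad.
- rewrite (drop1 j) lt_j on.
  by case: (nth La w j); case: b; rewrite /= scan_seen /= /sep_bad.
Qed.

Lemma scan_words o ok v j f ws :
  let f' w := f w || op_bad o j w in
  lscan (Word o ok v None) (words_cells j f ws) =
  (Word o (ok && all (fun w => f' w == v) ws) v None, words_cells (op_off o j) f' ws).
Proof.
rewrite /words_cells; elim: ws ok => [|w ws IH] ok /=; first by rewrite andbT.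
by rewrite scan_cat scan_word /= IH /= andbA.
Qed.

Lemma scan_got o b y :
  lscan (Got o b) (map (cert_cell false) y) = (Got o b, map (cert_cell false) y).
Proof. by elim: y => //= c y ->. Qed.

Lemma scan_tape o j f U V bs y1 y2 :
  let f' w := f w || op_bad o j w in
  let ok := all (predC f') U && all f' V in
  let: (s, t) := lscan (start o) (tape j f U V bs y1 y2) in
  if y2 is b :: y2' then
    if bin_val bs == 0 then s = Dead
    else s = Got o b /\ t = tape (op_off o j) f' U V (decr true bs) (rcons y1 b) y2'
  else s = Num o ok (bin_val bs == 0).
Proof.
move=> f' ok; rewrite /start /tape.
rewrite scan_cat scan_words [lscan _ (_ :: _)]/= scan_cat scan_words /= scan_cat scan_num /=.
have E1 o' ok' w : lscan (Num o' ok' w) (map (cert_cell true) y1)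
    = (Num o' ok' w, map (cert_cell true) y1).
  by elim: y1 => //= b y1 ->.
rewrite scan_cat E1 /= borrowE.
have -> : all (fun w => f w || op_bad o j w == false) U = all (predC f') U.
  by apply: eq_all => w /=; rewrite eqbF_neg.
have -> : all (fun w => f w || op_bad o j w == true) V = all f' V.
  by apply: eq_all => w /=; rewrite eqb_id.
case: y2 => [|b y2] /=; first by case: (bin_val bs).
case: (bin_val bs) => [|k] /=.
  by have := scan_Dead (map (cert_cell false) y2); case: (lscan _ _).
by rewrite scan_got /= map_rcons cat_rcons.
Qed.

(* [o] is the pending operation and [y] the unread part of the certificate. *)
Fixpoint bads (o : op) (j : nat) (y : seq bool) (w : word) : bool :=
  op_bad o j w || if y is b :: y' then bads (next_op o b) (op_off o j) y' w else false.

(** Each unread bit takes one sweep and one unit of the counter; one more sweep performs the last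
    pending operation and gives the verdict. Failures found so far accumulate in [f]. *)
Lemma sweeps_tape m o j f U V bs y1 y2 :
  let f' w := f w || bads o j y2 w in
  lsweeps m (start o) (tape j f U V bs y1 y2) =
  [&& size y2 < m, size y2 <= bin_val bs, is_chk (foldl next_op o y2),
      all (predC f') U & all f' V].
Proof.
elim: m o j f bs y1 y2 => [|m IH] o j f bs y1 y2 f'; first by [].
rewrite sweepsS; have := scan_tape o j f U V bs y1 y2.
case: (lscan _ _) => s t; rewrite [(_, _).1]/= [(_, _).2]/=.
rewrite {}/f'; case: y2 => [|b y2] /=.
  move=> -> /=.
  have E : (fun w => f w || op_bad o j w) =1 (fun w => f w || (op_bad o j w || false)).
    by move=> w; rewrite orbF.
  have EC : predC (fun w => f w || op_bad o j w) =1
      predC (fun w => f w || (op_bad o j w || false)).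
    by move=> w /=; rewrite orbF.
  rewrite -(eq_all E V) -(eq_all EC U).
  case: (_ && all _ V); rewrite /= ?andbT ?andbF ?sweeps_Dead //.
  by case: (is_chk o); rewrite ?sweeps_Dead.
case: eqP => [v0 ->|/eqP v0 [-> ->]] /=; first by rewrite sweeps_Dead v0 andbF.
rewrite IH bin_val_decr; last by lia.
rewrite ltnS; congr (_ && _); congr (_ && _); first by lia.
by congr (_ && (_ && _)); apply: eq_all => w /=; rewrite orbA.
Qed.

(** * Recognition of well-formed inputs *)

Definition in_cell (a : sym + bool) : cell := (a, false).

Definition sym_cell (a : sym) : cell := (inl a, false).

Definition fmt_state (s : state) : bool :=
  match s with Dead | FmtWord _ _ | FmtNum _ => true | _ => false end.

Lemma scan_fmt_state s x : fmt_state s -> fmt_state (lscan s (map sym_cell x)).1.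
Proof.
elim: x s => // a x IH s fs.
have : fmt_state (delta s (sym_cell a)).1.
  by case: s fs => // [[] []|[]] _; case: a.
by move=> /IH; rewrite [map _ _]/= scan_cons.
Qed.

Definition bit_sym (b : bool) : sym := if b then S1 else S0.

Lemma parse_num l x : (lscan (FmtNum l) (map sym_cell x)).1 = FmtNum true ->
  exists2 bs, x = map bit_sym bs & last l bs.
Proof.
elim: x l => [|a x IH] l; first by case=> ->; exists [::].
rewrite [map _ _]/= scan_cons.
case: a => //=; rewrite ?scan_Dead //; case: l => //=; rewrite ?scan_Dead // => /IH [bs -> lbs];
  by [exists (false :: bs) | exists (true :: bs)].
Qed.

(** The induction has to start inside a word as well: for [w = true], [w0] is the unread rest of
    that word, possibly empty because a letter has already been seen. *)
Lemma parse_words v w x : (lscan (FmtWord v w) (map sym_cell x)).1 = FmtNum true ->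
  exists w0 ws x',
    [/\ x = (if w then map sym_of_letter w0 ++ [:: Ssep] else [::])
              ++ enc_words ws ++ Sbar :: x',
        all (fun u => 0 < size u) ws
      & (lscan (if v then FmtNum true else FmtWord true false) (map sym_cell x')).1
          = FmtNum true].
Proof.
elim: x w => [|a x IH] w //; rewrite [map _ _]/= scan_cons.
have consE c : (lscan (FmtWord v true) (map sym_cell x)).1 = FmtNum true ->
    exists w0 ws x',
    [/\ sym_of_letter c :: x = (if w then map sym_of_letter w0 ++ [:: Ssep] else [::])
              ++ enc_words ws ++ Sbar :: x',
        all (fun u => 0 < size u) ws
      & (lscan (if v then FmtNum true else FmtWord true false) (map sym_cell x')).1
          = FmtNum true].
  move=> /IH [w0 [ws [x' [-> aws H]]]]; case: (w).
    by exists (c :: w0), ws, x'.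
  exists [::], ((c :: w0) :: ws), x'; split=> //=.
  by rewrite /enc_words /= -!catA.
case: a; case: w consE => consE /=; rewrite ?scan_Dead //;
  try by [move/(consE La) | move/(consE Lb)].
- move=> /IH [_ [ws [x' [-> aws H]]]].
  by exists [::], ws, x'.
- by move=> H; exists [::], [::], x.
Qed.

Lemma scan_fmt_letters v w u :
  lscan (FmtWord v w) (map sym_cell (map sym_of_letter u))
  = (FmtWord v (w || (0 < size u)), map sym_cell (map sym_of_letter u)).
Proof.
elim: u w => [|c u IH] w /=; first by rewrite orbF.
by rewrite orbT; case: c; case: w; rewrite /= IH.
Qed.

Lemma scan_fmt_words v ws : all (fun u => 0 < size u) ws ->
  lscan (FmtWord v false) (map sym_cell (enc_words ws))
  = (FmtWord v false, map sym_cell (enc_words ws)).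
Proof.
rewrite /enc_words; elim: ws => //= u ws IH /andP[u0 /IH E].
by rewrite !map_cat !scan_cat scan_fmt_letters u0 /= E.
Qed.

Lemma scan_fmt_num l bs :
  lscan (FmtNum l) (map sym_cell (map bit_sym bs))
  = (FmtNum (last l bs), map sym_cell (map bit_sym bs)).
Proof. by elim: bs l => //= -[] bs IH [] /=; rewrite IH. Qed.

Lemma scan_fmt U V bs : bin_canonical bs ->
  all (fun u => 0 < size u) U -> all (fun v => 0 < size v) V ->
  lscan (FmtWord false false) (map sym_cell (enc_inst U V bs))
  = (FmtNum true, map sym_cell (enc_inst U V bs)).
Proof.
move=> can_bs U0 V0; rewrite /enc_inst map_cat scan_cat scan_fmt_words //=.
by rewrite map_cat scan_cat scan_fmt_words //= -/(map bit_sym _) scan_fmt_num [last true bs]can_bs.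
Qed.

Definition input (x : seq sym) (y : seq bool) : seq cell :=
  map in_cell (map inl x ++ map inr y).

Lemma inputE x y : input x y = map sym_cell x ++ map (cert_cell false) y.
Proof. by rewrite /input map_cat -!map_comp. Qed.

Lemma enc_words_cells ws : map sym_cell (enc_words ws) = words_cells 0 (fun _ => false) ws.
Proof.
rewrite /enc_words /words_cells map_flatten -map_comp; congr flatten.
by apply: eq_map => w; rewrite /= /word_cells take0 drop0 map_cat -map_comp.
Qed.

Definition fails (j : nat) (y : seq bool) (w : word) : bool :=
  if y is b :: y' then bads (next_op OpX b) j y' w else false.

(** The bound is [k.+1] as a chain takes one bit more than its formula; the last operation must be a
    check because a chain ends in an atom. *)
Definition cert_ok (U V : seq word) (k : nat) (y : seq bool) : bool :=
  [&& size y <= k.+1, is_chk (foldl next_op OpX y),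
      all (predC (fails 0 y)) U & all (fails 0 y) V].

(** The format sweep consumes the first bit without decrementing the counter, which yields the extra
    unit in the bound of [cert_ok]. *)
Lemma sweeps_inst U V bs m y : bin_canonical bs ->
  all (fun u => 0 < size u) U -> all (fun v => 0 < size v) V ->
  lsweeps m.+1 (FmtWord false false) (input (enc_inst U V bs) y)
  = (size y <= m) && cert_ok U V (bin_val bs) y.
Proof.
move=> can_bs U0 V0; rewrite sweepsS inputE scan_cat scan_fmt //=.
case: y => [|b y] /=; first by rewrite cats0 sweeps_Dead.
have E : lscan (FmtGot b) (map (cert_cell false) y) = (FmtGot b, map (cert_cell false) y).
  by elim: y => //= c y ->.
rewrite E /= -/(input _ _) /cert_ok /= ltnS.
have -> : map sym_cell (enc_inst U V bs) ++ (inr b, true) :: map (cert_cell false) y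
    = tape 0 (fun _ => false) U V bs [:: b] y.
  rewrite /tape /enc_inst !map_cat /= map_cat /= !enc_words_cells -!catA /= -!catA /=.
  by rewrite -map_comp; congr (_ ++ _ :: _ ++ _ :: _ ++ _); apply: eq_map; case.
by rewrite sweeps_tape.
Qed.

Lemma sweeps_parse m x y : lsweeps m (FmtWord false false) (input x y) ->
  exists U V bs, [/\ x = enc_inst U V bs, bin_canonical bs,
    all (fun u => 0 < size u) U & all (fun v => 0 < size v) V].
Proof.
case: m => // m; rewrite sweepsS inputE scan_cat /=.
have := @scan_fmt_state (FmtWord false false) x isT.
case E: (lscan _ (map sym_cell x)) => [s t] /= fs H.
(* [fin] rejects every format state, and a first certificate bit kills all of them except
   [FmtNum true]. *)
have {H} Es : s = FmtNum true.
  case: y H => [|b y].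
    by case: s fs {E} => [|v w|[]|b|o ok v seen|o ok w|o b] //= _; rewrite sweeps_Dead.
  rewrite [map _ _]/= scan_cons.
  by case: s fs {E} => [|v []|[]|c|o ok v seen|o ok w|o c] //= _; rewrite scan_Dead /= sweeps_Dead.
have : (lscan (FmtWord false false) (map sym_cell x)).1 = FmtNum true by rewrite E.
move=> /parse_words [_ [U [x1 [-> U0 /parse_words [_ [V [x2 [-> V0 /parse_num]]]]]]]].
by case=> bs -> can_bs; exists U, V, bs.
Qed.

(** * Formulas and certificates *)

Lemma holds_bound w i f : holds w i f -> 0 < i <= size w.
Proof. by elim: f i => [c i []|f IHf g IHg i [/IHf]|f IH i [H _]] //; lia. Qed.

Lemma onth_holds w j c : holds w j.+1 (FAtom c) <-> onth w j = Some c.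
Proof.
split=> [[H <-]|H]; first by rewrite onthE (nth_map La).
have lt_j : j < size w by rewrite -onthTE H.
by split; [lia | apply: onth_nth].
Qed.

Lemma fails_X j y w : fails j (false :: y) w = fails j.+1 y w.
Proof. by case: y. Qed.

Lemma fails_chk j b y w :
  fails j [:: true, b & y] w = (onth w j != Some (letter_of b)) || fails j y w.
Proof. by case: y. Qed.

(** A step beyond the word records no failure by itself; the check that closes the chain does, in
    agreement with the length condition of [FX]. *)
Lemma cert_formula y : is_chk (foldl next_op OpX y) ->
  exists2 f, fsize f < size y & forall w j, holds w j.+1 f <-> ~~ fails j y w.
Proof.
have [n] := ubnP (size y); elim: n y => // n IH [|[] [|b y]] // sz.
- case: y sz => [|b' y] sz chk.
    exists (FAtom (letter_of b)) => // w j.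
    by rewrite onth_holds fails_chk orbF negbK; split=> [->|/eqP].
  have [|//|f szf Hf] := IH (b' :: y); first by rewrite /= in sz *; lia.
  exists (FAnd (FAtom (letter_of b)) f) => [|w j]; first by rewrite /= in szf *; lia.
  rewrite fails_chk negb_or negbK [holds _ _ (FAnd _ _)]/= -/(holds w j.+1 (FAtom _)).
  rewrite onth_holds Hf; split=> [[-> ->]|/andP[/eqP ->]] //.
  by rewrite eqxx.
- move=> chk; have [|//|f szf Hf] := IH (b :: y); first by rewrite /= in sz *; lia.
  exists (FX f) => // w j; rewrite fails_X -Hf /=; split=> [[]//|H].
  by have := holds_bound H; split=> //; lia.
Qed.

(** * Constrained offsets of a formula *)

Fixpoint mask_or (m1 m2 : seq bool) : seq bool :=
  match m1, m2 with
  | b1 :: m1', b2 :: m2' => (b1 || b2) :: mask_or m1' m2'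
  | [::], _ => m2
  | _, [::] => m1
  end.

(** Characteristic sequence of the constrained offsets. Letters are dropped: they will be read off a
    word satisfying the formula. *)
Fixpoint mask (f : ltlxa) : seq bool :=
  match f with
  | FAtom _ => [:: true]
  | FAnd f g => mask_or (mask f) (mask g)
  | FX f => false :: mask f
  end.

Lemma nth_mask_or m1 m2 i :
  nth false (mask_or m1 m2) i = nth false m1 i || nth false m2 i.
Proof.
elim: m1 m2 i => [|b1 m1 IH] [|b2 m2] [|i] //=; rewrite ?nth_nil ?orbF //.
Qed.

Lemma size_mask_or m1 m2 : size (mask_or m1 m2) = maxn (size m1) (size m2).
Proof. by elim: m1 m2 => [|b1 m1 IH] [|b2 m2] //=; rewrite ?IH; lia. Qed.

Lemma count_mask_or m1 m2 :
  count id (mask_or m1 m2) <= count id m1 + count id m2.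
Proof. by elim: m1 m2 => [|b1 m1 IH] [|b2 m2] //=; rewrite ?addn0 //; have := IH m2; lia. Qed.

Lemma last_mask f : last false (mask f).
Proof.
rewrite -nth_last; elim: f => //= [f IHf g IHg|f IH].
  rewrite nth_mask_or size_mask_or.
  by case: (leqP (size (mask g)) (size (mask f))) => _; rewrite ?IHf ?IHg ?orbT.
by case: (mask f) IH.
Qed.

Lemma size_mask_gt0 f : 0 < size (mask f).
Proof. by have := last_mask f; case: (mask f). Qed.

(** The left side is one more than the bit length of the chain with this mask, whose formula is thus
    no larger than [f]. Under [FAnd] counts at most add and sizes combine by maximum; the smaller
    size, at least 1, absorbs the surplus constant. *)
Lemma mask_weight f : 2 * count id (mask f) + size (mask f) <= fsize f + 2.
Proof.
elim: f => //= [f IHf g IHg|f IH]; last by lia.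
rewrite size_mask_or; have := count_mask_or (mask f) (mask g).
by have := size_mask_gt0 f; have := size_mask_gt0 g; lia.
Qed.

Lemma size_mask_holds u j f : holds u j.+1 f -> size (mask f) + j <= size u.
Proof.
elim: f j => [c j [] /=|f IHf g IHg j /= [/IHf Hf /IHg Hg]|f IH j /= [_ /IH]]; try lia.
by rewrite size_mask_or; lia.
Qed.

(** All letter constraints of [f] agree with [u], so none conflict and the mask determines [f]
    relative to [u]; the length conditions of [FX] follow from the constraints further on. *)
Lemma holds_mask u j f : holds u j.+1 f -> forall w k,
  holds w k.+1 f <-> forall i, nth false (mask f) i -> onth w (k + i) = onth u (j + i).
Proof.
elim: f j => [c|f IHf g IHg|f IH] j Hu w k.
- have Eu : onth u j = Some c by apply/onth_holds.
  rewrite onth_holds; split=> [Ew [|[]] //= _|/(_ 0 isT)]; first by rewrite !addn0 Ew.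
  by rewrite !addn0 Eu.
- case: Hu => Hf Hg; have {}Hf := IHf _ Hf w k; have {}Hg := IHg _ Hg w k.
  split=> [[/Hf H1 /Hg H2] i|H].
    by rewrite nth_mask_or => /orP[/H1|/H2].
  by split; [apply/Hf | apply/Hg] => i Hi; apply: H; rewrite nth_mask_or Hi ?orbT.
- case: Hu => _ Hf; have {}Hf := IH _ Hf w k.+1; split=> [[_ /Hf H] [|i] //= /H|H].
    by rewrite !addnS.
  suff Hw : holds w k.+2 f by have := holds_bound Hw; split=> //; lia.
  by apply/Hf => i Hi; have := H i.+1 Hi; rewrite !addnS.
Qed.

(** * Short certificates from separating formulas *)

Definition letter_bit (c : letter) : bool := c == Lb.

Lemma letter_bitK : cancel letter_bit letter_of.
Proof. by case. Qed.

(** An X bit is written only between offsets, so that the chain closes with a check when the mask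
    ends in [true]. *)
Fixpoint mask_cert (m : seq bool) (u : word) : seq bool :=
  match m, u with
  | b :: m', c :: u' =>
      (if b then [:: true; letter_bit c] else [::])
      ++ (if m' is [::] then [::] else false :: mask_cert m' u')
  | _, _ => [::]
  end.

Lemma fails_mask_cert m u w k : size m <= size u ->
  ~~ fails k (mask_cert m u) w <->
  forall i, nth false m i -> onth w (k + i) = onth u i.
Proof.
elim: m u k => [|b m IH] [|c u] k //= sz; try by split=> // _ [|i].
have -> : ~~ fails k ((if b then [:: true; letter_bit c] else [::])
      ++ (if m is [::] then [::] else false :: mask_cert m u)) w
    = (b ==> (onth w k == Some c)) && ~~ fails k.+1 (mask_cert m u) w.
  have E : fails k (if m is [::] then [::] else false :: mask_cert m u) w
      = fails k.+1 (mask_cert m u) w by case: (m) => // *; rewrite fails_X.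
  by case: b; rewrite [_ ++ _]/= ?fails_chk E ?letter_bitK ?negb_or ?negbK.
split=> [/andP[/implyP H0 /IH H] [|i] /=|H].
- by rewrite addn0 => /H0 /eqP.
- by rewrite addnS -addSn; apply: H.
- apply/andP; split; first by apply/implyP => /(H 0); rewrite addn0 => ->.
  by apply/IH => // i Hi; have := H i.+1 Hi; rewrite addnS addSn.
Qed.

Lemma chk_mask_cert m u : size m <= size u -> last false m ->
  is_chk (foldl next_op OpX (mask_cert m u)).
Proof.
elim: m u => [|b [|b' m] IH] [|c u] //= sz; first by case: b.
by move=> l; have := IH u sz l; case: b {IH}.
Qed.

Lemma size_mask_cert m u : 0 < size m <= size u ->
  (size (mask_cert m u)).+1 = 2 * count id m + size m.
Proof.
elim: m u => [|b [|b' m] IH] [|c u] //= sz; first by case: b.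
have := IH u sz; rewrite size_cat /= => ->; case: b => /=; lia.
Qed.

(** Each position of [u] costs at most two bits for a check and one for X, whatever the size of
    [f]. *)
Lemma formula_cert f u : models u f ->
  exists y, [/\ size y <= (fsize f).+1, size y <= 3 * size u,
    is_chk (foldl next_op OpX y) & forall w, models w f <-> ~~ fails 0 y w].
Proof.
move=> Hu; have szm := size_mask_holds Hu; rewrite addn0 in szm.
have szy := @size_mask_cert (mask f) u; rewrite size_mask_gt0 szm in szy.
have {}szy := szy isT.
exists (mask_cert (mask f) u); split.
- by have := mask_weight f; lia.
- by have := count_size id (mask f); lia.
- by rewrite chk_mask_cert ?last_mask.
- move=> w; apply: iff_trans (holds_mask Hu w 0) _.
  by apply: iff_sym; apply: fails_mask_cert.
Qed.

Lemma size_enc_words ws u : u \in ws -> size u <= size (enc_words ws).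
Proof.
elim: ws => //= w ws IH; rewrite inE /enc_words /= !size_cat size_map => /orP[/eqP ->|/IH] /=.
  by lia.
by rewrite /enc_words; lia.
Qed.

Lemma fsize_gt0 f : 0 < fsize f.
Proof. by case: f. Qed.

Lemma small_satisfiable f : fsize f <= 2 -> exists2 u, size u = 2 & models u f.
Proof.
case: f => [c|f g|[c|f g|f]] /=.
- by exists [:: c; c].
- by have := fsize_gt0 f; have := fsize_gt0 g; lia.
- by exists [:: c; c].
- by have := fsize_gt0 f; have := fsize_gt0 g; lia.
- by have := fsize_gt0 f; lia.
Qed.

Lemma separates_cert f U V k : fsize f <= k -> separates f U V ->
  exists2 y, size y <= 3 * size (enc_words U) + 6 & cert_ok U V k y.
Proof.
move=> le_k [HU HV].
(* The slack 2 admits the two-letter model of a formula of size at most 2, used when there is no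
   positive word. *)
have cert u : models u f -> size u <= size (enc_words U) + 2 ->
    exists2 y, size y <= 3 * size (enc_words U) + 6 & cert_ok U V k y.
  move=> /formula_cert [y [szf szu chk Hy]] szU.
  exists y; first by lia.
  rewrite /cert_ok chk (leq_trans szf) //=; apply/andP; split; apply/allP => w Hw /=.
    by apply/Hy/HU.
  by apply/negPn/negP => /Hy; apply: HV.
case: U HU cert => [|u U] HU cert; last first.
  apply: (cert u); first by apply: HU; rewrite mem_head.
  exact: leq_trans (size_enc_words (mem_head u U)) (leq_addr _ _).
case: (leqP (fsize f) 2) => [/small_satisfiable [u szu Hu]|gt2].
  by apply: (cert u); rewrite // szu.
(* The tokens check [La] and then [Lb] at offset 0: a contradiction of size 3, affordable since [k]
   is at least 3. *)
exists [:: true; false; true; true] => //.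
apply/and4P; split=> //; first exact: leq_trans gt2 le_k.
apply/allP => v _.
by case: v => [|[] v].
Qed.

Lemma cert_separates U V k y : cert_ok U V k y ->
  exists f, fsize f <= k /\ separates f U V.
Proof.
case/and4P => szy /cert_formula [f szf Hf] /allP HU /allP HV.
exists f; split; first by lia.
by split=> [u /HU /= Hu|v /HV Hv /Hf]; [apply/Hf | rewrite Hv].
Qed.

Lemma in_cell_inj : injective in_cell.
Proof. by move=> a b []. Qed.

Theorem theorem2 : in_NP LTLXA_learning.
Proof.
(* With L = [(size x).+1], the certificate has at most 3 L bits, hence there are at most 3 L + 1
   sweeps over at most 4 L cells, at most 8 L steps each; 120 L^2 leaves room. *)
exists (sweep_TM (FmtWord false false) delta fin in_cell_inj), 120, 2 => x; split.
  move=> [U [V [bs [-> can_bs U0 V0 [f [le_k /(separates_cert le_k) [y szy ok]]]]]]].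
  have szs : size (enc_words U) < size (enc_inst U V bs) by rewrite size_cat /=; lia.
  have := sweeps_inst (size y) y can_bs U0 V0; rewrite leqnn ok /input.
  move: (enc_inst U V bs) szs => s szs H.
  exists y; split; first by nia.
  have : size (map inl s ++ map inr y : seq (sym + bool)) = size s + size y.
    by rewrite size_cat !size_map.
  case: (map inl s ++ map inr y) H => [|a t] H; rewrite [size _]/= => szt; first by lia.
  have [n [le_n acc]] := sweep_TM_complete in_cell_inj H.
  by exists n; split=> //; nia.
move=> [y [_ /sweep_TM_sound [m]]]; rewrite -/(input x y) => H.
have [U [V [bs [Ex can_bs U0 V0]]]] := sweeps_parse H.
exists U, V, bs; split=> //.
case: m H => // m; rewrite Ex sweeps_inst // => /andP[_].
exact: cert_separates.
Qed.
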